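(* For every positive integer $n$ with $n \notin \{3, 5, 7\}$, the rational number $$ \frac{(2 n)!^2}{4^n} \sum_{k = 1}^{n} \frac{2 + (n + k) H_{n + k - 1}}{(n + k)^2 \, 2^{n - k}} $$ is a positive integer.
   Context: The harmonic numbers are $H_0 = 0$ and $H_m = \frac{1}{1} + \frac{1}{2} + \cdots + \frac{1}{m}$ for every positive integer $m$. The notation $(2n)!^2$ means $((2n)!)^2$. *)

(* Defs.v *)
From mathcomp Require Import all_boot all_order all_algebra.

Set Implicit Arguments.
Unset Strict Implicit.
Unset Printing Implicit Defensive.

Import Order.TTheory GRing.Theory Num.Theory.
Local Open Scope ring_scope.

Definition harmonic (m : nat) : rat := \sum_(1 <= i < m.+1) i%:R^-1.

(* Main.v *)
(** Put m = n + k and F = (2n)!.  Since 2 + m H_(m-1) = 1 + m H_m, the k-th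
    summand times F^2 / 4^n is F^2 / 2^(4n - m) times
    1/m^2 + sum_(1 <= i <= m) 1/(i m).  As i and m divide F, only the prime 2
    can obstruct integrality, and by Legendre's formula F^2 / (2^(4n - m) i m)
    is an integer once 2 s(n) + v_2(i) + v_2(m) <= m, with s(n) the binary digit
    sum of n.  This is true for n = 4 and all n >= 8; for n = 1, 2, 6 it fails
    only at a k with n + k a power of 2, where the summand is evaluated
    explicitly. *)
Require Import Defs.
From mathcomp Require Import all_boot all_order all_algebra.
From mathcomp Require Import zify ring.

Set Implicit Arguments.
Unset Strict Implicit.
Unset Printing Implicit Defensive.

Import Order.TTheory GRing.Theory Num.Theory.
Local Open Scope ring_scope.

(** The odd factors of (2n)! contribute nothing, and each even factor 2j contributes one more than j
    does. *)
Lemma logn2_fact_double n : logn 2 (n.*2)`! = (n + logn 2 n`!)%N.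
Proof.
elim: n => [|n IHn]; first by rewrite fact0.
rewrite doubleS !factS !lognM ?muln_gt0 ?fact_gt0 // IHn.
have -> : n.*2.+2 = (2 * n.+1)%N by lia.
rewrite lognM // (@lognE 2 2) /=.
have -> : logn 2 n.*2.+1 = 0%N.
  by rewrite lognE dvdn2 /= odd_double.
by have -> : logn 2 1 = 0%N by []; lia.
Qed.

(* [s] is the binary digit sum of [n] (Legendre's formula). *)
Lemma logn2_fact n : exists2 s, (s + logn 2 n`!)%N = n & (2 ^ s <= n.+1)%N.
Proof.
elim/ltn_ind: n => n IHn; case: (posnP n) => [->|n_gt0]; first by exists 0%N.
have [|s Es le_s] := IHn n./2; first lia.
case: (boolP (odd n)) (odd_double_half n) => n_odd n_half.
  exists s.+1; last by rewrite expnS; lia.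
  rewrite -[in LHS]n_half factS lognM ?fact_gt0 // logn2_fact_double.
  have -> : logn 2 n./2.*2.+1 = 0%N by rewrite lognE dvdn2 /= odd_double.
  lia.
exists s; last lia.
by rewrite -[in LHS]n_half logn2_fact_double; lia.
Qed.

(** Away from p, the parts of i and m each divide that of F, so their product divides its square; at
    p, only exponents have to be compared. *)
Lemma dvdn_mul_logn p e i m F : prime p -> (0 < F)%N -> (i %| F)%N -> (m %| F)%N ->
  (e + logn p i + logn p m <= 2 * logn p F)%N -> (p ^ e * (i * m) %| F ^ 2)%N.
Proof.
move=> p_pr F_gt0 iF mF le_e.
have i_gt0 := dvdn_gt0 F_gt0 iF; have m_gt0 := dvdn_gt0 F_gt0 mF.
have -> : (p ^ e * (i * m) =
           p ^ (e + logn p i + logn p m) * (i`_p^' * m`_p^'))%N.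
  rewrite -[in LHS](partnC p i_gt0) -[in LHS](partnC p m_gt0) !p_part !expnD.
  ring.
rewrite -(partnC p F_gt0) expnMn p_part -expnM [(logn p F * 2)%N]mulnC.
rewrite dvdn_mul ?dvdn_exp2l // -mulnn dvdn_mul //; exact: partn_dvd.
Qed.

Lemma exp_logn_leq p m : (0 < m)%N -> (p ^ logn p m <= m)%N.
Proof. by move=> m_gt0; rewrite dvdn_leq // pfactor_dvdnn. Qed.

Lemma logn2_lt t m : (0 < m < 2 ^ t)%N -> (logn 2 m < t)%N.
Proof.
case/andP=> m_gt0 m_lt; rewrite -(ltn_exp2l _ _ (isT : 1 < 2)%N).
exact: leq_ltn_trans (exp_logn_leq 2 m_gt0) m_lt.
Qed.

Lemma leq_4mul_exp2 t : (4 <= t)%N -> (4 * t <= 2 ^ t)%N.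
Proof.
elim: t => // t IHt; rewrite leq_eqVlt => /predU1P[[<-] //|].
by rewrite ltnS expnS => t_ge; have := IHt t_ge; lia.
Qed.

(** For m >= 16, let t be the floor of log_2 m: s and both valuations are at most t, and 4t <= 2^t
    <= m because t >= 4. For 9 <= m <= 15, s and v_2(i) are at most 3, so 2s + v_2(i) <= 9 and seven
    values of m remain to be checked. *)
Lemma digit_sum_logn2_bound n s m i : (8 <= n)%N -> (2 ^ s <= n.+1)%N ->
  (n < m)%N -> (0 < i <= m)%N -> (2 * s + logn 2 i + logn 2 m <= m)%N.
Proof.
move=> n_ge8 le_s lt_nm /andP[i_gt0 le_im].
have m_gt0 : (0 < m)%N by lia.
case: (leqP 16 m) => m_16.
  have le_log r : (2 ^ r <= m)%N -> (r <= trunc_log 2 m)%N.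
    by move=> ?; apply: trunc_log_max.
  have s_le : (s <= trunc_log 2 m)%N by apply: le_log; lia.
  have v_le : (logn 2 m <= trunc_log 2 m)%N by exact/le_log/exp_logn_leq.
  have u_le : (logn 2 i <= trunc_log 2 m)%N.
    by apply: le_log; apply: leq_trans (exp_logn_leq 2 i_gt0) le_im.
  have t_ge4 : (4 <= trunc_log 2 m)%N by apply: le_log.
  have := leq_4mul_exp2 t_ge4; have := trunc_logP (isT : 1 < 2)%N m_gt0; lia.
have s_lt : (s < 4)%N.
  by rewrite -(ltn_exp2l _ _ (isT : 1 < 2)%N) (_ : 2 ^ 4 = 16)%N //; lia.
have u_lt : (logn 2 i < 4)%N by apply: logn2_lt; rewrite i_gt0 /=; lia.
suff : (9 + logn 2 m <= m)%N by lia.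
have : m \in iota 9 7 by rewrite mem_iota; lia.
by move: m {lt_nm le_im m_gt0 m_16}; apply/allP.
Qed.

Lemma natr_div_int (d N : nat) : (d %| N)%N -> (N%:R / d%:R : rat) \is a Num.int.
Proof.
(* For d = 0 the quotient is 0, by the convention that 0 has inverse 0. *)
case: (posnP d) => [-> _|d_gt0 /dvdnP[c ->]]; first by rewrite invr0 mulr0.
by rewrite natrM mulfK ?pnatr_eq0 -?lt0n // rpred_nat.
Qed.

Lemma harmonic_ge0 m : 0 <= harmonic m.
Proof. by apply: sumr_ge0 => i _; rewrite invr_ge0. Qed.

Lemma harmonicS m : harmonic m.+1 = harmonic m + m.+1%:R^-1.
Proof. by rewrite /harmonic big_nat_recr. Qed.

Lemma harmonic0 : harmonic 0 = 0.
Proof. by rewrite /harmonic big_geq. Qed.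

Lemma summand_int n k s :
  (0 < k <= n)%N -> (s + logn 2 n`!)%N = n ->
  (forall i, 0 < i <= n + k -> 2 * s + logn 2 i + logn 2 (n + k) <= n + k)%N ->
  ((2 * n)`!)%:R ^+ 2 / 4 ^+ n *
  ((2 + (n + k)%:R * harmonic (n + k - 1)) /
   ((n + k)%:R ^+ 2 * 2 ^+ (n - k))) \is a Num.int.
Proof.
case/andP=> k_gt0 le_kn def_s bound.
set m := (n + k)%N in bound *; set F := ((2 * n)`!)%N.
have m_gt0 : (0 < m)%N by rewrite /m; lia.
have F_gt0 : (0 < F)%N by exact: fact_gt0.
have m_neq0 : m%:R != 0 :> rat by rewrite pnatr_eq0 -lt0n.
have logF : logn 2 F = (n + logn 2 n`!)%N.
  by rewrite /F mul2n logn2_fact_double.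
have term_int i : (0 < i <= m)%N ->
    (F ^ 2)%:R / (2 ^ (2 * n + (n - k)) * (i * m))%:R \is a @Num.int rat.
  move=> /[dup] i_bd /andP[i_gt0 le_im]; apply: natr_div_int.
  have dvdF j : (0 < j <= m)%N -> (j %| F)%N.
    by move=> ?; apply: dvdn_fact; rewrite /m in le_im *; lia.
  apply: dvdn_mul_logn => //; [exact: dvdF|by apply: dvdF; rewrite m_gt0 /=|].
  (* Since v_2(F) = 2n - s, the required 3n - k + v_2(i) + v_2(m) <= 2 v_2(F) is [bound]
     rearranged. *)
  by have := bound i i_bd; rewrite logF /m; lia.
have E4 : 4 ^+ n = 2 ^+ (2 * n) :> rat by rewrite exprM; congr (_ ^+ n); ring.
(* The isolated first summand has the shape of the term i = m, so [term_int] covers it too. *)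
suff -> : F%:R ^+ 2 / 4 ^+ n * ((2 + m%:R * harmonic (m - 1)) /
    (m%:R ^+ 2 * 2 ^+ (n - k))) =
    (F ^ 2)%:R / (2 ^ (2 * n + (n - k)) * (m * m))%:R +
    \sum_(1 <= i < m.+1) (F ^ 2)%:R / (2 ^ (2 * n + (n - k)) * (i * m))%:R.
  apply: rpredD; first by apply: term_int; rewrite m_gt0 /=.
  rewrite big_seq; apply: rpred_sum => i; rewrite mem_index_iota => i_bd.
  exact: term_int.
have -> : \sum_(1 <= i < m.+1) (F ^ 2)%:R /
      (2 ^ (2 * n + (n - k)) * (i * m))%:R =
    (F ^ 2)%:R / (2 ^ (2 * n + (n - k)) * m)%:R * harmonic m :> rat.
  rewrite mulr_sumr; apply: eq_bigr => i _.
  by rewrite !natrM !invfM; ring.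
have -> : harmonic m = harmonic (m - 1) + m%:R^-1.
  by rewrite subn1 -{1 3}(prednK m_gt0) harmonicS.
rewrite E4 !natrM !natrX exprD; field.
by rewrite m_neq0 !expf_neq0.
Qed.

Theorem corollary2p5 (n : nat) (n_gt0 : (0 < n)%N)
    (n_exc : n \notin [:: 3; 5; 7]%N) :
  let q : rat :=
    ((2 * n)`!)%:R ^+ 2 / 4 ^+ n *
    \sum_(1 <= k < n.+1)
      (2 + (n + k)%:R * harmonic (n + k - 1)) /
      ((n + k)%:R ^+ 2 * 2 ^+ (n - k)) in
  q \is a Num.int /\ 0 < q.
Proof.
move=> q; split; last first.
  have F_gt0 : 0 < ((2 * n)`!)%:R ^+ 2 / 4 ^+ n :> rat.
    by rewrite divr_gt0 ?exprn_gt0 // ltr0n fact_gt0.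
  have term_gt0 k : (0 < k)%N -> 0 < (2 + (n + k)%:R * harmonic (n + k - 1)) /
      ((n + k)%:R ^+ 2 * 2 ^+ (n - k)) :> rat.
    move=> k_gt0; rewrite divr_gt0 ?mulr_gt0 ?exprn_gt0 ?ltr0n ?addn_gt0 ?k_gt0 ?orbT
      //.
    by rewrite ltr_wpDr // mulr_ge0 ?ler0n ?harmonic_ge0.
  rewrite mulr_gt0 // big_nat_recl //= ltr_wpDr ?term_gt0 //.
  by apply: sumr_ge0 => k _; rewrite ltW ?term_gt0.
pose term k : rat := ((2 * n)`!)%:R ^+ 2 / 4 ^+ n *
  ((2 + (n + k)%:R * harmonic (n + k - 1)) /
   ((n + k)%:R ^+ 2 * 2 ^+ (n - k))).
have q_int : (forall k, (0 < k <= n)%N -> term k \is a Num.int) ->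
    q \is a Num.int.
  move=> term_int; rewrite /q mulr_sumr big_seq; apply: rpred_sum => k.
  by rewrite mem_index_iota; apply: term_int.
apply: q_int; case: (leqP 8 n) => n_8.
  have [s def_s le_s] := logn2_fact n; move=> k k_bd.
  apply: (summand_int k_bd def_s) => i i_bd.
  by apply: (digit_sum_logn2_bound n_8 le_s) => //; lia.
(* For a concrete n the bound is a finite check, left to computation over the list [ks] of those k
   for which it holds. *)
have small_int s (ks : seq nat) : (s + logn 2 n`!)%N = n ->
    all (fun k => all (fun i =>
      2 * s + logn 2 i + logn 2 (n + k) <= n + k)%N (iota 1 (n + k))) ks ->
    forall k, (0 < k <= n)%N -> k \in ks -> term k \is a Num.int.
  move=> def_s /allP bound k k_bd /bound/allP bound_k.
  apply: (summand_int k_bd def_s) => i i_bd.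
  by apply: bound_k; rewrite mem_iota; lia.
have : n \in [:: 1; 2; 4; 6]%N by move: n_exc; rewrite !inE; lia.
rewrite !inE => /or4P[] /eqP n_eq; subst n => k k_bd.
- have -> : k = 1%N by lia.
  have -> : term 1%N = 1; last exact: rpred1.
  rewrite /term -[(1 + 1)%N]/2%N -[(2 - 1)%N]/1%N -[(1 - 1)%N]/0%N.
  by rewrite -[(2 * 1)%N]/2%N !factS fact0 !harmonicS harmonic0; field.
(* At k = 2 the bound fails for i = m = 4, as 2 + 2 + 2 > 4. *)
- case: (eqVneq k 2%N) => [->|k_neq].
    have -> : term 2%N = 21; last exact: rpred_nat.
    rewrite /term -[(2 + 2)%N]/4%N -[(4 - 1)%N]/3%N -[(2 - 2)%N]/0%N.
    rewrite -[(2 * 2)%N]/4%N !factS fact0.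
    by rewrite !harmonicS harmonic0; field.
  by apply: (small_int 1%N [:: 1%N]) => //; rewrite inE; lia.
- by apply: (small_int 1%N (iota 1 4)) => //; rewrite mem_iota; lia.
- case: (eqVneq k 2%N) => [->|k_neq].
    (* Here 12! = 2^10 * 35 * (5 * 2673) and 2 + 8 H_7 = 4 * 199 / 35; the powers of 2 cancel
       against 4^6 * 8^2 * 2^4 = 2^22. *)
    have -> : term 2%N = 35 * (5 * 2673) ^+ 2 * 199; last first.
      apply: rpredM (rpred_nat _ 199); apply: rpredM (rpred_nat _ 35) _.
      by apply: rpredX; apply: rpredM; apply: rpred_nat.
    rewrite /term -[(6 + 2)%N]/8%N -[(8 - 1)%N]/7%N -[(6 - 2)%N]/4%N.
    have -> : harmonic 7 = 363 / 140 by rewrite !harmonicS harmonic0; field.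
    have -> : ((2 * 6)`!)%:R = 2 ^+ 10 * 35 * (5 * 2673) :> rat.
      by rewrite -[(2 * 6)%N]/12%N !factS fact0 !natrM; ring.
    by field.
  by apply: (small_int 2%N [:: 1; 3; 4; 5; 6]%N) => //; rewrite !inE; lia.
Qed.
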